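(* Let $\mathcal{C}$ and $\mathcal{C}'$ be full triangulated subcategories of a triangulated category $\mathcal{D}$ such that $\mathcal{C}$ reflects $\mathcal{C}'$ in $\mathcal{D}$, and let $w$ be a weight structure on $\mathcal{C}$. Then the following conditions are equivalent. (i) There exists a $t$-structure $t$ on $\mathcal{C}'$ right orthogonal to $w$. (ii) The functor $\tau_{\ge 0}H_{M'}$ is $\mathcal{D}$-representable by an object of $\mathcal{C}'$ for any object $M'$ of $\mathcal{C}'$. (iii) The functor $\tau_{\le -1}H_{M'}$ is $\mathcal{D}$-representable by an object of $\mathcal{C}'$ for any object $M'$ of $\mathcal{C}'$. (iv) For any object $M'$ of $\mathcal{C}'$ and any $i\in \mathbb{Z}$ the functors $\tau_{\ge i}H_{M'}$ and $\tau_{\le i}H_{M'}$ are $\mathcal{D}$-representable by objects of $\mathcal{C}'$.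
   Context: For classes of objects $A,B$ of $\mathcal{D}$ write $A\perp_{\mathcal{D}} B$ if every $\mathcal{D}$-morphism from an object of $A$ to an object of $B$ is zero. A weight structure $w$ on a triangulated category $\mathcal{C}$ is a pair of classes $\mathcal{C}_{w\le 0},\mathcal{C}_{w\ge 0}\subset \operatorname{Obj}\mathcal{C}$, both closed under retracts in $\mathcal{C}$, such that $\mathcal{C}_{w\le 0}\subset \mathcal{C}_{w\le 0}[1]$, $\mathcal{C}_{w\ge 0}[1]\subset \mathcal{C}_{w\ge 0}$, $\mathcal{C}_{w\le 0}\perp \mathcal{C}_{w\ge 0}[1]$, and every object $M$ fits into a distinguished triangle $L\to M\to R\to L[1]$ with $L\in \mathcal{C}_{w\le 0}$, $R\in \mathcal{C}_{w\ge 0}[1]$. Put $\mathcal{C}_{w\le i}=\mathcal{C}_{w\le 0}[i]$, $\mathcal{C}_{w\ge i}=\mathcal{C}_{w\ge 0}[i]$. For $m\in\mathbb{Z}$, an $m$-weight decomposition of $M$ is a distinguished triangle $w_{\le m}M\to M\to w_{\ge m+1}M\to (w_{\le m}M)[1]$ with $w_{\le m}M\in \mathcal{C}_{w\le m}$, $w_{\ge m+1}M\in\mathcal{C}_{w\ge m+1}$ (it exists but is not canonical). For $m<n$ and fixed $m$- and $n$-weight decompositions of $M$, there is a unique morphism of triangles from the former to the latter extending $\mathrm{id}_M$; it gives connecting morphisms $w_{\le m}M\to w_{\le n}M$ and $w_{\ge m+1}M\to w_{\ge n+1}M$. For a cohomological functor $H:\mathcal{C}^{op}\to \mathrm{Ab}$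 and $n\in\mathbb{Z}$ the virtual $t$-truncations are the functors $\tau_{\le n}(H)(M)=\operatorname{Im}(H(w_{\le n+1}M)\to H(w_{\le n}M))$ and $\tau_{\ge n}(H)(M)=\operatorname{Im}(H(w_{\ge n}M)\to H(w_{\ge n-1}M))$, defined via the connecting morphisms (they are well-defined cohomological functors independent of choices). A $t$-structure $t$ on $\mathcal{C}'$ (homological convention) is a pair of isomorphism-closed classes $\mathcal{C}'_{t\le 0},\mathcal{C}'_{t\ge 0}$ with $\mathcal{C}'_{t\le 0}\subset \mathcal{C}'_{t\le 0}[1]$, $\mathcal{C}'_{t\ge 0}[1]\subset \mathcal{C}'_{t\ge 0}$, $\mathcal{C}'_{t\ge 0}[1]\perp \mathcal{C}'_{t\le 0}$, and such that every $M$ fits into a distinguished triangle $L\to M\to R\to L[1]$ with $L\in \mathcal{C}'_{t\ge 0}$, $R\in \mathcal{C}'_{t\le 0}[-1]$; $\mathcal{C}'_{t\le i}=\mathcal{C}'_{t\le 0}[i]$, $\mathcal{C}'_{t\ge i}=\mathcal{C}'_{t\ge 0}[i]$. $t$ is right orthogonal to $w$ if $\mathcal{C}_{w\le 0}\perp_{\mathcal{D}}\mathcal{C}'_{t\ge 1}$ and $\mathcal{C}_{w\ge 0}\perp_{\mathcal{D}}\mathcal{C}'_{t\le -1}$. For $N\in\operatorname{Obj}\mathcal{D}$, $H_N:\mathcal{C}^{op}\to\mathrm{Ab}$ denotes the restriction of $\mathcal{D}(-,N)$ to $\mathcal{C}$; a functor $\mathcal{C}^{op}\to \mathrm{Ab}$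 is $\mathcal{D}$-representable by $N$ if it is isomorphic to $H_N$. $\mathcal{C}$ reflects $\mathcal{C}'$ (in $\mathcal{D}$) if the functor $N\mapsto H_N$ from $\mathcal{C}'$ to the category of additive functors $\mathcal{C}^{op}\to\mathrm{Ab}$ is fully faithful. *)

(* Defs.v *)
From HB Require Import structures.
From mathcomp Require Import all_boot all_order all_algebra.
From mathcomp Require Import boolp.

Set Implicit Arguments.
Unset Strict Implicit.
Unset Printing Implicit Defensive.

Import Order.TTheory GRing.Theory Num.Theory.
Local Open Scope ring_scope.

Declare Scope cat_scope.
Delimit Scope cat_scope with cat.
Local Open Scope cat_scope.

(* The choice structure that MathComp puts on every Z-module is no restriction:
   classically, every type has one. *)
Record preadditive := Preadditive {
  Obj :> Type;
  Hom : Obj -> Obj -> zmodType;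
  idm : forall X, Hom X X;
  comp : forall X Y Z, Hom Y Z -> Hom X Y -> Hom X Z;
  comp1m : forall X Y (f : Hom X Y), comp (idm Y) f = f;
  compm1 : forall X Y (f : Hom X Y), comp f (idm X) = f;
  compA : forall X Y Z T (h : Hom Z T) (g : Hom Y Z) (f : Hom X Y),
    comp h (comp g f) = comp (comp h g) f;
  compDl : forall X Y Z (g g' : Hom Y Z) (f : Hom X Y),
    comp (g + g') f = comp g f + comp g' f;
  compDr : forall X Y Z (g : Hom Y Z) (f f' : Hom X Y),
    comp g (f + f') = comp g f + comp g f' }.

Arguments Hom {p} X Y.
Arguments idm {p} X.
Arguments comp {p X Y Z} g f.
Notation "g \oc f" := (comp g f) (at level 40, left associativity) : cat_scope.

Section Objects.
Variable C : preadditive.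
Implicit Types X Y Z : C.

Definition is_zero Z :=
  forall X, (forall f : Hom X Z, f = 0) /\ (forall f : Hom Z X, f = 0).

Definition is_iso X Y (f : Hom X Y) :=
  exists g : Hom Y X, g \oc f = idm X /\ f \oc g = idm Y.

Definition isomorphic X Y := exists f : Hom X Y, is_iso f.

Definition retract X Y :=
  exists (i : Hom X Y) (p : Hom Y X), p \oc i = idm X.

Definition is_biproduct X Y B :=
  exists (i1 : Hom X B) (i2 : Hom Y B) (p1 : Hom B X) (p2 : Hom B Y),
    [/\ p1 \oc i1 = idm X, p2 \oc i2 = idm Y, p2 \oc i1 = 0, p1 \oc i2 = 0
      & i1 \oc p1 + i2 \oc p2 = idm B].

Definition cls := C -> Prop.

Definition iso_closed (A : cls) := forall X Y, A X -> isomorphic X Y -> A Y.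

Definition retract_closed (A : cls) := forall X Y, A Y -> retract X Y -> A X.

Definition orth (A B : cls) :=
  forall X Y, A X -> B Y -> forall f : Hom X Y, f = 0.

End Objects.

Record functor (C D : preadditive) := Functor {
  fobj :> C -> D;
  fmap : forall X Y : C, Hom X Y -> Hom (fobj X) (fobj Y);
  fmap1 : forall X, fmap (idm X) = idm (fobj X);
  fmapM : forall X Y Z (g : Hom Y Z) (f : Hom X Y),
    fmap (g \oc f) = fmap g \oc fmap f;
  fmapD : forall X Y (f g : Hom X Y), fmap (f + g) = fmap f + fmap g }.

Arguments fmap {C D} f {X Y} g : rename.

(* The shift is an autoequivalence, not necessarily an automorphism: [unshift]
   is a quasi-inverse.  The octahedral axiom is stated for arbitrary triangles
   on f, g and g \oc f. *)
Record tricat := Tricat {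
  tcat :> preadditive;
  tzero : exists Z : tcat, is_zero Z;
  tbiprod : forall X Y : tcat, exists B, is_biproduct X Y B;
  shift : functor tcat tcat;
  unshift : functor tcat tcat;
  shiftK : forall X, Hom (unshift (shift X)) X;
  shiftK_iso : forall X, is_iso (shiftK X);
  shiftK_nat : forall X Y (f : Hom X Y),
    f \oc shiftK X = shiftK Y \oc fmap unshift (fmap shift f);
  unshiftK : forall X, Hom (shift (unshift X)) X;
  unshiftK_iso : forall X, is_iso (unshiftK X);
  unshiftK_nat : forall X Y (f : Hom X Y),
    f \oc unshiftK X = unshiftK Y \oc fmap shift (fmap unshift f);
  dist : forall X Y Z : tcat, Hom X Y -> Hom Y Z -> Hom Z (shift X) -> Prop;
  dist_iso : forall X Y Z X' Y' Z'
      (f : Hom X Y) (g : Hom Y Z) (h : Hom Z (shift X))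
      (f' : Hom X' Y') (g' : Hom Y' Z') (h' : Hom Z' (shift X'))
      (a : Hom X X') (b : Hom Y Y') (c : Hom Z Z'),
    is_iso a -> is_iso b -> is_iso c ->
    b \oc f = f' \oc a -> c \oc g = g' \oc b -> fmap shift a \oc h = h' \oc c ->
    dist f g h -> dist f' g' h';
  dist_id : forall X Z : tcat, is_zero Z ->
    dist (idm X) (0 : Hom X Z) (0 : Hom Z (shift X));
  dist_cone : forall X Y (f : Hom X Y),
    exists (Z : tcat) (g : Hom Y Z) (h : Hom Z (shift X)), dist f g h;
  dist_rot : forall X Y Z (f : Hom X Y) (g : Hom Y Z) (h : Hom Z (shift X)),
    dist f g h <-> dist g h (- fmap shift f);
  dist_map : forall X Y Z X' Y' Z'
      (f : Hom X Y) (g : Hom Y Z) (h : Hom Z (shift X))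
      (f' : Hom X' Y') (g' : Hom Y' Z') (h' : Hom Z' (shift X'))
      (a : Hom X X') (b : Hom Y Y'),
    dist f g h -> dist f' g' h' -> b \oc f = f' \oc a ->
    exists c : Hom Z Z', c \oc g = g' \oc b /\ fmap shift a \oc h = h' \oc c;
  dist_octahedron : forall X Y Z U V W
      (f : Hom X Y) (f1 : Hom Y U) (f2 : Hom U (shift X))
      (g : Hom Y Z) (g1 : Hom Z V) (g2 : Hom V (shift Y))
      (k1 : Hom Z W) (k2 : Hom W (shift X)),
    dist f f1 f2 -> dist g g1 g2 -> dist (g \oc f) k1 k2 ->
    exists (p : Hom U W) (q : Hom W V),
      [/\ p \oc f1 = k1 \oc g, k2 \oc p = f2, q \oc k1 = g1,
          g2 \oc q = fmap shift f \oc k2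
        & dist p q (fmap shift f1 \oc g2)] }.

Arguments shift {t}.
Arguments unshift {t}.
Arguments shiftK {t} X.
Arguments unshiftK {t} X.
Arguments dist {t X Y Z} f g h.

(* X[n]; recall that Negz k stands for - (k + 1). *)
Definition shiftz (C : tricat) (n : int) (X : C) : C :=
  match n with
  | Posz k => iter k (@shift C) X
  | Negz k => iter k.+1 (@unshift C) X
  end.

(* A[n], closed under isomorphism because the shift is only an equivalence. *)
Definition shiftcls (C : tricat) (A : cls C) (n : int) : cls C :=
  fun M => exists X, A X /\ isomorphic (shiftz n X) M.

(* A full triangulated subcategory, given by its objects; it need not be closed
   under isomorphism in the ambient category. *)
Record trisub (D : tricat) := Trisub {
  sub_mem :> D -> Prop;
  sub_zero : exists Z, sub_mem Z /\ is_zero Z;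
  sub_biprod : forall X Y, sub_mem X -> sub_mem Y ->
    exists B, sub_mem B /\ is_biproduct X Y B;
  sub_shift : forall X, sub_mem X -> sub_mem (shift X);
  sub_unshift : forall X, sub_mem X -> sub_mem (unshift X);
  sub_cone : forall X Y Z (f : Hom X Y) (g : Hom Y Z) (h : Hom Z (shift X)),
    dist f g h -> sub_mem X -> sub_mem Y ->
    exists Z', sub_mem Z' /\ isomorphic Z Z' }.

Section FullSubcategory.
Variables (D : tricat) (P : trisub D).

Definition sub_preadditive : preadditive :=
  @Preadditive {X : D | P X} (fun X Y => Hom (sval X) (sval Y))
    (fun X => idm (sval X)) (fun X Y Z g f => comp g f)
    (fun X Y f => comp1m f) (fun X Y f => compm1 f)
    (fun X Y Z T h g f => compA h g f)
    (fun X Y Z g g' f => compDl g g' f) (fun X Y Z g f f' => compDr g f f').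

Definition sub_functor (F : functor D D) (FP : forall X, P X -> P (F X)) :
    functor sub_preadditive sub_preadditive :=
  @Functor sub_preadditive sub_preadditive
    (fun X => exist _ (F (sval X)) (FP _ (svalP X)))
    (fun X Y f => fmap F f)
    (fun X => fmap1 F (sval X)) (fun X Y Z g f => fmapM F g f)
    (fun X Y f g => fmapD F f g).

Fact sub_tzero : exists Z : sub_preadditive, is_zero Z.
Proof.
by have [Z [PZ Z0]] := sub_zero P; exists (exist _ Z PZ) => X; apply: Z0.
Qed.

Fact sub_tbiprod (X Y : sub_preadditive) : exists B, is_biproduct X Y B.
Proof.
by have [B [PB XYB]] := sub_biprod (svalP X) (svalP Y); exists (exist _ B PB).
Qed.

Fact sub_dist_cone (X Y : sub_preadditive) (f : Hom X Y) :
  exists (Z : sub_preadditive) (g : Hom Y Z)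
    (h : Hom Z (sub_functor (@sub_shift D P) X)),
    @dist D (sval X) (sval Y) (sval Z) f g h.
Proof.
have [Z [g [h fgh]]] := @dist_cone D (sval X) (sval Y) f.
have [Z' [PZ' [u [v [vu uv]]]]] := sub_cone fgh (svalP X) (svalP Y).
exists (exist _ Z' PZ'), (u \oc g), (h \oc v).
apply: (dist_iso (a := idm _) (b := idm _) (c := u)) fgh.
- by exists (idm _); rewrite !comp1m.
- by exists (idm _); rewrite !comp1m.
- by exists v.
- by rewrite comp1m compm1.
- by rewrite compm1.
- by rewrite fmap1 comp1m -compA vu compm1.
Qed.

Fact sub_dist_id (X Z : sub_preadditive) : is_zero Z ->
  @dist D (sval X) (sval X) (sval Z) (idm X) (0 : Hom X Z) 0.
Proof.
move=> Z0; have [Z1 Z10] := tzero D.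
apply: (dist_iso (a := idm _) (b := idm _) (c := 0)) (dist_id (sval X) Z10).
- by exists (idm _); rewrite !comp1m.
- by exists (idm _); rewrite !comp1m.
- exists 0; split; [have [h _] := Z10 Z1 | have [h _] := Z0 Z];
    exact: etrans (h _) (esym (h _)).
- by [].
- by have [h _] := Z0 X; apply: etrans (h _) (esym (h _)).
- by have [_ h] := Z10 (shift (sval X)); apply: etrans (h _) (esym (h _)).
Qed.

Definition fullsub : tricat :=
  @Tricat sub_preadditive sub_tzero sub_tbiprod
    (sub_functor (@sub_shift D P)) (sub_functor (@sub_unshift D P))
    (fun X => shiftK (sval X)) (fun X => shiftK_iso (sval X))
    (fun X Y f => shiftK_nat f)
    (fun X => unshiftK (sval X)) (fun X => unshiftK_iso (sval X))
    (fun X Y f => unshiftK_nat f)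
    (fun X Y Z f g h => @dist D (sval X) (sval Y) (sval Z) f g h)
    (fun X Y Z X' Y' Z' => @dist_iso D _ _ _ (sval X') (sval Y') (sval Z'))
    sub_dist_id sub_dist_cone
    (fun X Y Z => @dist_rot D (sval X) (sval Y) (sval Z))
    (fun X Y Z X' Y' Z' => @dist_map D _ _ _ (sval X') (sval Y') (sval Z'))
    (fun X Y Z U V W => @dist_octahedron D _ _ _ (sval U) (sval V) (sval W)).

(* A class of objects of the subcategory, as a class of objects of D. *)
Definition inD (A : cls fullsub) : cls D :=
  fun X => exists PX : P X, A (exist _ X PX).

End FullSubcategory.

Record weight_structure (C : tricat) := WeightStructure {
  wle0 : cls C;
  wge0 : cls C;
  wle0_retract : retract_closed wle0;
  wge0_retract : retract_closed wge0;
  wle0_shift : forall M, wle0 M -> shiftcls wle0 1 M;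
  wge0_shift : forall M, shiftcls wge0 1 M -> wge0 M;
  w_orth : orth wle0 (shiftcls wge0 1);
  w_decomp : forall M, exists (L R : C)
      (l : Hom L M) (r : Hom M R) (h : Hom R (shift L)),
    [/\ wle0 L, shiftcls wge0 1 R & dist l r h] }.

Definition w_le (C : tricat) (w : weight_structure C) i := shiftcls (wle0 w) i.
Definition w_ge (C : tricat) (w : weight_structure C) i := shiftcls (wge0 w) i.

Record t_structure (C : tricat) := TStructure {
  tle0 : cls C;
  tge0 : cls C;
  tle0_iso : iso_closed tle0;
  tge0_iso : iso_closed tge0;
  tle0_shift : forall M, tle0 M -> shiftcls tle0 1 M;
  tge0_shift : forall M, shiftcls tge0 1 M -> tge0 M;
  t_orth : orth (shiftcls tge0 1) tle0;
  t_decomp : forall M, exists (L R : C)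
      (l : Hom L M) (r : Hom M R) (h : Hom R (shift L)),
    [/\ tge0 L, shiftcls tle0 (-1) R & dist l r h] }.

Definition t_le (C : tricat) (t : t_structure C) i := shiftcls (tle0 t) i.
Definition t_ge (C : tricat) (t : t_structure C) i := shiftcls (tge0 t) i.

Definition right_orthogonal (D : tricat) (C C' : trisub D)
    (w : weight_structure (fullsub C)) (t : t_structure (fullsub C')) :=
  orth (inD (w_le w 0)) (inD (t_ge t 1)) /\
  orth (inD (w_ge w 0)) (inD (t_le t (-1))).

(* Additive functors from the opposite category to abelian groups. *)
Record presheaf (C : preadditive) := Presheaf {
  pobj :> C -> zmodType;
  pmap : forall X Y : C, Hom X Y -> {additive pobj Y -> pobj X};
  pmap1 : forall X (x : pobj X), pmap (idm X) x = x;
  pmapM : forall X Y Z (g : Hom Y Z) (f : Hom X Y) (z : pobj Z),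
    pmap (g \oc f) z = pmap f (pmap g z);
  pmapD : forall X Y (f g : Hom X Y) (y : pobj Y),
    pmap (f + g) y = pmap f y + pmap g y }.

Arguments pmap {C} p {X Y} f : rename.

Record nat_trans (C : preadditive) (F G : presheaf C) := NatTrans {
  nt_app :> forall X, {additive F X -> G X};
  nt_nat : forall X Y (f : Hom X Y) (y : F Y),
    nt_app X (pmap F f y) = pmap G f (nt_app Y y) }.

Definition presheaf_iso (C : preadditive) (F G : presheaf C) :=
  exists (a : nat_trans F G) (b : nat_trans G F),
    (forall X x, b X (a X x) = x) /\ (forall X y, a X (b X y) = y).

Section HomGroups.
Variables (C : preadditive) (X Y Z : C).

Definition precomp (f : Hom X Y) (g : Hom Y Z) : Hom X Z := g \oc f.
Definition postcomp (g : Hom Y Z) (f : Hom X Y) : Hom X Z := g \oc f.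

Lemma comp0m (f : Hom X Y) : (0 : Hom Y Z) \oc f = 0.
Proof. by apply: (@addrI _ (0 \oc f)); rewrite -compDl !addr0. Qed.

Lemma compm0 (g : Hom Y Z) : g \oc (0 : Hom X Y) = 0.
Proof. by apply: (@addrI _ (g \oc 0)); rewrite -compDr !addr0. Qed.

Lemma compNm (g : Hom Y Z) (f : Hom X Y) : (- g) \oc f = - (g \oc f).
Proof. by apply: (@addrI _ (g \oc f)); rewrite -compDl !subrr comp0m. Qed.

Lemma compmN (g : Hom Y Z) (f : Hom X Y) : g \oc (- f) = - (g \oc f).
Proof. by apply: (@addrI _ (g \oc f)); rewrite -compDr !subrr compm0. Qed.

Fact precomp_additive f : zmod_morphism (precomp f).
Proof. by move=> g g'; rewrite /precomp compDl compNm. Qed.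

Fact postcomp_additive g : zmod_morphism (postcomp g).
Proof. by move=> f f'; rewrite /postcomp compDr compmN. Qed.

HB.instance Definition _ f :=
  GRing.isZmodMorphism.Build (Hom Y Z) (Hom X Z) (precomp f)
    (precomp_additive f).
HB.instance Definition _ g :=
  GRing.isZmodMorphism.Build (Hom X Y) (Hom X Z) (postcomp g)
    (postcomp_additive g).

End HomGroups.

Section Representable.
Variables (D : tricat) (C C' : trisub D).

(* H_N, the restriction to C of the presheaf represented by N. *)
Definition H_ (N : D) : presheaf (fullsub C) :=
  @Presheaf (fullsub C) (fun M => Hom (sval M) N)
    (fun M M' (f : @Hom D (sval M) (sval M')) => @precomp D _ _ N f)
    (fun M x => compm1 x) (fun M M' M'' g f x => compA x g f)
    (fun M M' f g x => compDr x f g).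

Definition H_map (N N' : D) (g : Hom N N') : nat_trans (H_ N) (H_ N') :=
  @NatTrans _ (H_ N) (H_ N') (fun M => @postcomp D (sval M) N N' g)
    (fun M M' f x => compA g x f).

(* N |-> H_N is fully faithful on C'. *)
Definition reflects :=
  forall N N' : fullsub C',
    (forall g g' : @Hom D (sval N) (sval N'),
       (forall M x, H_map g M x = H_map g' M x) -> g = g') /\
    (forall a : nat_trans (H_ (sval N)) (H_ (sval N')),
       exists g : @Hom D (sval N) (sval N'), forall M x, H_map g M x = a M x).

Definition representable_in (F : presheaf (fullsub C)) :=
  exists N : fullsub C', presheaf_iso F (H_ (sval N)).

End Representable.

Section Image.
Variables (U V : zmodType) (f : {additive U -> V}).

Definition im_pred : {pred V} := fun v => `[< exists u, f u = v >].

Fact im_pred_closed : zmod_closed im_pred.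
Proof.
split=> [|v v' /asboolP[u <-] /asboolP[u' <-]]; apply/asboolP.
  by exists 0; rewrite raddf0.
by exists (u - u'); rewrite raddfB.
Qed.
HB.instance Definition _ :=
  GRing.isZmodClosed.Build V im_pred im_pred_closed.

Record im := Im { im_val :> V; _ : im_val \in im_pred }.
HB.instance Definition _ := [isSub for im_val].
HB.instance Definition _ := [Choice of im by <:].
HB.instance Definition _ := [SubChoice_isSubZmodule of im by <:].

Lemma imP (x : im) : exists u, f u = im_val x.
Proof. by case: x => v /= /asboolP. Qed.

Lemma mem_im u : f u \in im_pred.
Proof. by apply/asboolP; exists u. Qed.

End Image.

(* An arrow c between two choices of objects A M, B M that do not depend
   functorially on M, but such that the composites with c do. *)
Record weak_arrow (C : preadditive) := WeakArrow {
  wa_src : C -> C;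
  wa_tgt : C -> C;
  wa_arr : forall M, Hom (wa_src M) (wa_tgt M);
  wa_fsrc : forall M M', Hom M M' -> Hom (wa_src M) (wa_src M');
  wa_ftgt : forall M M', Hom M M' -> Hom (wa_tgt M) (wa_tgt M');
  wa_square : forall M M' (f : Hom M M'),
    wa_ftgt f \oc wa_arr M = wa_arr M' \oc wa_fsrc f;
  wa_id : forall M, wa_arr M \oc wa_fsrc (idm M) = wa_arr M;
  wa_comp : forall M M' M'' (g : Hom M' M'') (f : Hom M M'),
    wa_arr M'' \oc wa_fsrc (g \oc f) = wa_arr M'' \oc (wa_fsrc g \oc wa_fsrc f);
  wa_add : forall M M' (f g : Hom M M'),
    wa_arr M' \oc wa_fsrc (f + g) = wa_arr M' \oc (wa_fsrc f + wa_fsrc g) }.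

Section ImageFunctor.
Variables (C : preadditive) (c : weak_arrow C) (H : presheaf C).

Definition im_obj (M : C) : zmodType := im (pmap H (wa_arr c M)).

Fact im_map_subproof M M' (f : Hom M M') (x : im_obj M') :
  pmap H (wa_fsrc c f) (im_val x) \in im_pred (pmap H (wa_arr c M)).
Proof.
have [u <-] := imP x; rewrite -pmapM -wa_square pmapM; exact: mem_im.
Qed.

Definition im_map M M' (f : Hom M M') (x : im_obj M') : im_obj M :=
  Im (im_map_subproof f x).

Fact im_map_additive M M' (f : Hom M M') : zmod_morphism (im_map f).
Proof. by move=> x y; apply: val_inj; rewrite /= raddfB. Qed.
HB.instance Definition _ M M' (f : Hom M M') :=
  GRing.isZmodMorphism.Build (im_obj M') (im_obj M) (im_map f)
    (im_map_additive f).

Fact im_map1 M (x : im_obj M) : im_map (idm M) x = x.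
Proof.
by apply: val_inj => /=; have [u <-] := imP x; rewrite -pmapM wa_id.
Qed.

Fact im_mapM M M' M'' (g : Hom M' M'') (f : Hom M M') (x : im_obj M'') :
  im_map (g \oc f) x = im_map f (im_map g x).
Proof.
apply: val_inj => /=; have [u <-] := imP x.
by rewrite -!pmapM wa_comp compA.
Qed.

Fact im_mapD M M' (f g : Hom M M') (x : im_obj M') :
  im_map (f + g) x = im_map f x + im_map g x.
Proof.
apply: val_inj => /=; have [u <-] := imP x.
by rewrite -!pmapM wa_add compDr pmapD.
Qed.

(* M |-> Im (H (B M) -> H (A M)). *)
Definition im_presheaf : presheaf C :=
  @Presheaf C im_obj (fun M M' f => im_map f) im_map1 im_mapM im_mapD.

End ImageFunctor.

Section TriangleFacts.
Variable C : tricat.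
Implicit Types X Y Z : C.

Lemma is_iso_id (D : preadditive) (X : D) : is_iso (idm X).
Proof. by exists (idm _); rewrite comp1m. Qed.

Lemma is_iso_opp (D : preadditive) (X : D) : is_iso (- idm X).
Proof. by exists (- idm X); rewrite compNm compmN comp1m opprK. Qed.

Lemma isomorphic_refl (D : preadditive) (X : D) : isomorphic X X.
Proof. by exists (idm X); apply: is_iso_id. Qed.

Lemma isomorphic_sym (D : preadditive) (X Y : D) :
  isomorphic X Y -> isomorphic Y X.
Proof. by move=> [f [g [gf fg]]]; exists g, f. Qed.

Lemma isomorphic_trans (D : preadditive) (X Y Z : D) :
  isomorphic X Y -> isomorphic Y Z -> isomorphic X Z.
Proof.
move=> [f [g [gf fg]]] [f' [g' [gf' fg']]].
exists (f' \oc f), (g \oc g'); split.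
  by rewrite -compA (compA g') gf' comp1m.
by rewrite -compA (compA f) fg comp1m.
Qed.

Lemma functor_isomorphic (D E : preadditive) (F : functor D E) (X Y : D) :
  isomorphic X Y -> isomorphic (F X) (F Y).
Proof.
move=> [f [g [gf fg]]]; exists (fmap F f), (fmap F g).
by rewrite -!fmapM gf fg !fmap1.
Qed.

Lemma fmap0 (D E : preadditive) (F : functor D E) (X Y : D) :
  fmap F (0 : Hom X Y) = 0.
Proof. by apply: (@addrI _ (fmap F 0)); rewrite -fmapD !addr0. Qed.

Lemma fmapN (D E : preadditive) (F : functor D E) (X Y : D) (f : Hom X Y) :
  fmap F (- f) = - fmap F f.
Proof. by apply: (@addrI _ (fmap F f)); rewrite -fmapD !subrr fmap0. Qed.

Lemma fmapB (D E : preadditive) (F : functor D E) (X Y : D) (f g : Hom X Y) :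
  fmap F (f - g) = fmap F f - fmap F g.
Proof. by rewrite fmapD fmapN. Qed.

Lemma shift_inj X Y (f : Hom X Y) : fmap shift f = 0 -> f = 0.
Proof.
move=> Sf0; have [v [_ vK]] := shiftK_iso X.
by rewrite -[f]compm1 -vK compA shiftK_nat Sf0 fmap0 compm0 comp0m.
Qed.

Lemma unshift_inj X Y (f : Hom X Y) : fmap unshift f = 0 -> f = 0.
Proof.
move=> Sf0; have [v [_ vK]] := unshiftK_iso X.
by rewrite -[f]compm1 -vK compA unshiftK_nat Sf0 fmap0 compm0 comp0m.
Qed.

Lemma shift_full X Y (u : Hom (shift X) (shift Y)) :
  exists f : Hom X Y, fmap shift f = u.
Proof.
have [v [vK Kv]] := shiftK_iso X; have [v' [v'K Kv']] := shiftK_iso Y.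
exists (shiftK Y \oc fmap unshift u \oc v).
apply/eqP; rewrite -subr_eq0; apply/eqP/unshift_inj; rewrite fmapB.
apply/eqP; rewrite subr_eq0; apply/eqP.
rewrite -[LHS]comp1m -v'K -compA -shiftK_nat.
by rewrite -!compA vK compm1 compA v'K comp1m.
Qed.

Lemma shift_zero Z : is_zero Z -> is_zero (shift Z).
Proof.
move=> Z0 X.
have id0 : idm (shift Z) = 0.
  by rewrite -fmap1 (_ : idm Z = 0) ?fmap0 //; case: (Z0 Z).
split=> f; first by rewrite -[f]comp1m id0 comp0m.
by rewrite -[f]compm1 id0 compm0.
Qed.

Lemma dist_wker X Y Z (f : Hom X Y) (g : Hom Y Z) (h : Hom Z (shift X))
    W (u : Hom W Y) :
  dist f g h -> g \oc u = 0 -> exists v : Hom W X, u = f \oc v.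
Proof.
move=> fgh gu0; have [O O0] := tzero C.
have /dist_rot idW := dist_id W O0; have /dist_rot ghf := fgh.
have e : (0 : Hom O Z) \oc (0 : Hom W O) = g \oc u by rewrite gu0 comp0m.
have [k [_ ek]] := dist_map idW ghf e.
have [v Sv] := shift_full k; exists v; apply/eqP; rewrite -subr_eq0.
apply/eqP/shift_inj; rewrite fmapB fmapM Sv.
apply/eqP; rewrite subr_eq0 -eqr_opp; apply/eqP.
by move: ek; rewrite fmap1 compmN compNm compm1.
Qed.

Lemma dist_wcoker X Y Z (f : Hom X Y) (g : Hom Y Z) (h : Hom Z (shift X))
    W (u : Hom Y W) :
  dist f g h -> u \oc f = 0 -> exists v : Hom Z W, u = v \oc g.
Proof.
move=> fgh uf0; have [O O0] := tzero C.
have d : dist (0 : Hom O W) (idm W) (0 : Hom W (shift O)).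
  apply/dist_rot; rewrite fmap0 oppr0; exact: dist_id (shift_zero O0).
have e : u \oc f = (0 : Hom O W) \oc (0 : Hom X O) by rewrite uf0 comp0m.
have [v [ev _]] := dist_map fgh d e; exists v.
by rewrite ev comp1m.
Qed.

Lemma dist_wcoker2 X Y Z (f : Hom X Y) (g : Hom Y Z) (h : Hom Z (shift X))
    W (u : Hom Z W) :
  dist f g h -> u \oc g = 0 -> exists v : Hom (shift X) W, u = v \oc h.
Proof. by move=> /dist_rot; apply: dist_wcoker. Qed.

Lemma dist_shift X Y Z (f : Hom X Y) (g : Hom Y Z) (h : Hom Z (shift X)) :
  dist f g h <-> dist (fmap shift f) (fmap shift g) (- fmap shift h).
Proof.
rewrite dist_rot dist_rot dist_rot; split.
- apply: (dist_iso (a := idm _) (b := - idm _) (c := idm _)).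
  + exact: is_iso_id.
  + exact: is_iso_opp.
  + exact: is_iso_id.
  + by rewrite compNm compmN comp1m compm1 opprK.
  + by rewrite !compmN comp1m compm1.
  + by rewrite fmap1 comp1m compm1.
- apply: (dist_iso (a := idm _) (b := - idm _) (c := idm _)).
  + exact: is_iso_id.
  + exact: is_iso_opp.
  + exact: is_iso_id.
  + by rewrite compNm comp1m compm1.
  + by rewrite compNm compmN comp1m compm1 opprK.
  + by rewrite fmap1 comp1m compm1.
Qed.

Lemma dist_ends_iso X Y Z X' Y' Z' (f : Hom X Y) (g : Hom Y Z)
    (h : Hom Z (shift X)) :
  dist f g h -> isomorphic X X' -> isomorphic Y Y' -> isomorphic Z Z' ->
  exists (f' : Hom X' Y') (g' : Hom Y' Z') (h' : Hom Z' (shift X')),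
    dist f' g' h'.
Proof.
move=> fgh [a [a' [a'a aa']]] [b [b' [b'b bb']]] [c [c' [c'c cc']]].
exists (b \oc f \oc a'), (c \oc g \oc b'), (fmap shift a \oc h \oc c').
apply: (dist_iso (a := a) (b := b) (c := c)) fgh; [by exists a'|by exists b'|by exists c'| | |].
- by rewrite -compA a'a compm1.
- by rewrite -compA b'b compm1.
- by rewrite -compA c'c compm1.
Qed.

Lemma shiftzS n X : isomorphic (shift (shiftz n X)) (shiftz (n + 1) X).
Proof.
case: n => [n|[|n]].
- have -> : Posz n + 1 = Posz n.+1 by rewrite -addn1 PoszD.
  exact: isomorphic_refl.
- by exists (unshiftK X); apply: unshiftK_iso.
- have -> : Negz n.+1 + 1 = Negz n by rewrite !NegzE -addn1 PoszD opprD addrNK.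
  by exists (unshiftK (shiftz (Negz n) X)); apply: unshiftK_iso.
Qed.

Lemma isomorphic_shift X Y : isomorphic (shift X) (shift Y) -> isomorphic X Y.
Proof.
move=> /(functor_isomorphic (@unshift C)) XY.
have k Z : isomorphic (unshift (shift Z)) Z.
  by exists (shiftK Z); apply: shiftK_iso.
exact: isomorphic_trans (isomorphic_trans (isomorphic_sym (k X)) XY) (k Y).
Qed.

Lemma shiftclsS (A : cls C) n M :
  shiftcls A n M -> shiftcls A (n + 1) (shift M).
Proof.
move=> [X [AX XM]]; exists X; split=> //.
apply: isomorphic_trans (isomorphic_sym (shiftzS n X)) _.
exact: functor_isomorphic.
Qed.

Lemma shiftclsSE (A : cls C) n M :
  shiftcls A (n + 1) M ->
  exists M0, shiftcls A n M0 /\ isomorphic (shift M0) M.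
Proof.
move=> [X [AX XM]]; exists (shiftz n X); split.
  by exists X; split=> //; apply: isomorphic_refl.
exact: isomorphic_trans (shiftzS n X) XM.
Qed.

Lemma shiftz_iso n X Y : isomorphic X Y -> isomorphic (shiftz n X) (shiftz n Y).
Proof.
move=> XY; case: n => n /=; first by elim: n => // n; apply: functor_isomorphic.
apply: functor_isomorphic.
by elim: n => // n; apply: functor_isomorphic.
Qed.

Lemma shiftzA n X : isomorphic (shiftz n (shift X)) (shift (shiftz n X)).
Proof.
case: n => n.
  by rewrite /= -iterSr; apply: isomorphic_refl.
have k Z : isomorphic (unshift (shift Z)) Z.
  by exists (shiftK Z); apply: shiftK_iso.
have k' Z : isomorphic Z (shift (unshift Z)).
  by apply: isomorphic_sym; exists (unshiftK Z); apply: unshiftK_iso.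
rewrite /=; elim: n => [|n IH] /=; first exact: isomorphic_trans (k X) (k' X).
apply: isomorphic_trans (functor_isomorphic unshift IH) _.
exact: isomorphic_trans (k _) (k' _).
Qed.

Lemma int_step (P : int -> Prop) :
  P 0 -> (forall n, P n -> P (n + 1)) -> (forall n, P (n + 1) -> P n) ->
  forall n, P n.
Proof.
move=> P0 PS PD n; elim: n => [//|n /PS|n Pn].
  by rewrite -addn1 PoszD.
by apply: PD; rewrite -addn1 PoszD opprD addrNK.
Qed.

Lemma orth_iso (X Y X' Y' : C) : isomorphic X X' -> isomorphic Y Y' ->
  (forall f : Hom X Y, f = 0) -> forall f : Hom X' Y', f = 0.
Proof.
move=> [a [a' [a'a aa']]] [b [b' [b'b bb']]] h f.
rewrite -[f]comp1m -[f]compm1 -aa' -bb' !compA -(compA b b') -(compA b _ a).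
by rewrite [b' \oc f \oc a]h compm0 comp0m.
Qed.

End TriangleFacts.

Section WeightFacts.
Variables (C : tricat) (w : weight_structure C).
Implicit Types (M L R : C) (m n : int).

Lemma wle0_iso : iso_closed (wle0 w).
Proof.
move=> X Y wX [f [g [gf fg]]]; apply: (wle0_retract wX).
by exists g, f.
Qed.

Lemma w_leS m M : w_le w m M -> w_le w (m + 1) M.
Proof.
move=> [X [/wle0_shift[Y [wY YX]] XM]]; exists Y; split=> //.
apply: isomorphic_trans XM; apply: isomorphic_trans (shiftz_iso m YX).
apply: isomorphic_trans (isomorphic_sym (shiftzS m Y)) _.
exact: isomorphic_sym (shiftzA m Y).
Qed.

Lemma w_le_trans m n M : m <= n -> w_le w m M -> w_le w n M.
Proof.
move=> mn wM; rewrite -(subrKC m n); move: mn; rewrite -subr_ge0.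
case: (n - m) => // k _; elim: k => [|k IH]; first by rewrite addr0.
by rewrite -addn1 PoszD addrA; apply: w_leS.
Qed.

Lemma w_orth1 m : orth (w_le w m) (w_ge w (m + 1)).
Proof.
elim/int_step: m => [|m IH|m IH] X Y wX wY.
- move: wX => [X0 [wX0 X0X]]; rewrite add0r in wY.
  apply: w_orth wY; exact: wle0_iso X0X.
- have [X0 [wX0 X0X]] := shiftclsSE wX; have [Y0 [wY0 Y0Y]] := shiftclsSE wY.
  apply: orth_iso X0X Y0Y _ => f; have [g <-] := shift_full f.
  by rewrite (IH _ _ wX0 wY0 g) fmap0.
- move=> f; apply: shift_inj; apply: IH; exact: shiftclsS.
Qed.

Lemma w_orthz m n : m < n -> orth (w_le w m) (w_ge w n).
Proof.
move=> mn X Y wX wY; apply: (@w_orth1 (n - 1)); last by rewrite subrK.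
by apply: w_le_trans wX; rewrite -ltzD1 subrK.
Qed.

Record wdecomp m M := Wdecomp {
  wd_L : C;
  wd_R : C;
  wd_l : Hom wd_L M;
  wd_r : Hom M wd_R;
  wd_h : Hom wd_R (shift wd_L);
  wd_le : w_le w m wd_L;
  wd_ge : w_ge w (m + 1) wd_R;
  wd_dist : dist wd_l wd_r wd_h }.

Lemma wdecomp_exists m M : inhabited (wdecomp m M).
Proof.
elim/int_step: m M => [|m IH|m IH] M.
- have [L [R [l [r [h [wL wR d]]]]]] := w_decomp w M.
  split; apply: (@Wdecomp 0 M L R l r h) => //.
  by exists L; split=> //; apply: isomorphic_refl.
- have [[L R l r h wL wR /dist_shift d]] := IH (unshift M).
  have MM : isomorphic (shift (unshift M)) M.
    by exists (unshiftK M); apply: unshiftK_iso.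
  have [l' [r' [h' d']]] :=
    dist_ends_iso d (isomorphic_refl _) MM (isomorphic_refl _).
  by split; apply: Wdecomp d'; apply: shiftclsS.
- have [[L R l r h wL wR d]] := IH (shift M).
  have [L0 [wL0 LL]] := shiftclsSE wL; have [R0 [wR0 RR]] := shiftclsSE wR.
  have [l' [r' [h' d']]] :=
    dist_ends_iso d (isomorphic_sym LL) (isomorphic_refl _) (isomorphic_sym RR).
  have [l0 el] := shift_full l'; have [r0 er] := shift_full r'.
  have [h0 eh] := shift_full (- h').
  split; apply: (@Wdecomp m M L0 R0 l0 r0 h0) => //.
  by apply/dist_shift; rewrite el er eh opprK.
Qed.

(* The components (a, b) of a morphism from the triangle d to the triangle d'
   that extends f. *)
Definition wd_morphism m n M M' (d : wdecomp m M) (d' : wdecomp n M')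
    (f : Hom M M') (ab : Hom (wd_L d) (wd_L d') * Hom (wd_R d) (wd_R d')) :=
  [/\ wd_l d' \oc ab.1 = f \oc wd_l d, ab.2 \oc wd_r d = wd_r d' \oc f
    & wd_h d' \oc ab.2 = fmap shift ab.1 \oc wd_h d].

Lemma wd_morphism_exists m n M M' (d : wdecomp m M) (d' : wdecomp n M')
    (f : Hom M M') : m <= n -> exists ab, @wd_morphism m n M M' d d' f ab.
Proof.
move=> mn; have rfl : wd_r d' \oc (f \oc wd_l d) = 0.
  apply: (w_orthz (m := m) (n := n + 1)); first by rewrite ltzD1.
    exact: wd_le.
  exact: wd_ge.
have [a ea] := dist_wker (wd_dist d') rfl.
have [b [eb eh]] := dist_map (wd_dist d) (wd_dist d') ea.
by exists (a, b).
Qed.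

Lemma wd_morphism_uniq m n M M' (d : wdecomp m M) (d' : wdecomp n M')
    (f : Hom M M') ab ab' : m < n ->
  @wd_morphism m n M M' d d' f ab -> wd_morphism f ab' -> ab = ab'.
Proof.
have sub0 (V : zmodType) (x y : V) : x - y = 0 -> x = y.
  by move=> /eqP; rewrite subr_eq0 => /eqP.
have o : m < n -> orth (w_le w (m + 1)) (w_ge w (n + 1)).
  by move=> mn; apply: w_orthz; rewrite ltrD2r.
case: ab ab' => [a b] [a' b'] mn [/= la br _] [/= la' br' _]; congr (_, _).
- apply: sub0; apply: shift_inj.
  have /dist_rot d1 := wd_dist d'; have e : - fmap shift (wd_l d') \oc
    fmap shift (a - a') = 0.
    by rewrite compNm -fmapM compDr compmN la la' subrr fmap0 oppr0.
  have /dist_rot d2 := d1.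
  have [v ->] := dist_wker d2 (W := shift (wd_L d)) (u := fmap shift (a - a')) e.
  by rewrite (o mn _ _ (shiftclsS (wd_le d)) (wd_ge d') v) compm0.
- apply: sub0.
  have e : (b - b') \oc wd_r d = 0 by rewrite compDl compNm br br' subrr.
  have [v ->] := dist_wcoker2 (wd_dist d) e.
  by rewrite (o mn _ _ (shiftclsS (wd_le d)) (wd_ge d') v) comp0m.
Qed.

Lemma wd_morphism_comp m n p M M' M'' (d : wdecomp m M) (d' : wdecomp n M')
    (d'' : wdecomp p M'') (f : Hom M M') (g : Hom M' M'') ab ab' :
  @wd_morphism m n M M' d d' f ab -> @wd_morphism n p M' M'' d' d'' g ab' ->
  @wd_morphism m p M M'' d d'' (g \oc f) (ab'.1 \oc ab.1, ab'.2 \oc ab.2).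
Proof.
case: ab ab' => [a b] [a' b'] [/= la br hb] [/= la' br' hb']; split=> /=.
- by rewrite compA la' -compA la compA.
- by rewrite -compA br compA br' -compA.
- by rewrite compA hb' -compA hb compA -fmapM.
Qed.

Lemma wd_morphismD m n M M' (d : wdecomp m M) (d' : wdecomp n M')
    (f g : Hom M M') ab ab' :
  @wd_morphism m n M M' d d' f ab -> wd_morphism g ab' ->
  wd_morphism (f + g) (ab.1 + ab'.1, ab.2 + ab'.2).
Proof.
case: ab ab' => [a b] [a' b'] [/= la br hb] [/= la' br' hb']; split=> /=.
- by rewrite compDr compDl la la'.
- by rewrite compDr compDl br br'.
- by rewrite compDr fmapD compDl hb hb'.
Qed.

(* A chosen m-weight decomposition of M. *)
Definition wdec m M : wdecomp m M :=
  sval (cid (let: inhabits d := wdecomp_exists m M in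
             ex_intro (fun _ => True) d I)).

Definition w_ext m n (mn : m <= n) M M' (f : Hom M M') :=
  sval (cid (wd_morphism_exists (wdec m M) (wdec n M') f mn)).

Lemma w_extP m n (mn : m <= n) M M' (f : Hom M M') :
  wd_morphism f (w_ext mn f).
Proof. exact: svalP. Qed.

Lemma w_arrow_square m n (mn : m <= n) M M' (f : Hom M M') : m < n ->
  let c M := w_ext mn (idm M) in
  (w_ext (lexx n) f).1 \oc (c M).1 = (c M').1 \oc (w_ext (lexx m) f).1 /\
  (w_ext (lexx n) f).2 \oc (c M).2 = (c M').2 \oc (w_ext (lexx m) f).2.
Proof.
move=> lt_mn c.
have h1 := wd_morphism_comp (w_extP mn (idm M)) (w_extP (lexx n) f).
have h2 := wd_morphism_comp (w_extP (lexx m) f) (w_extP mn (idm M')).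
rewrite comp1m in h2; rewrite compm1 in h1.
by have [-> ->] := wd_morphism_uniq lt_mn h1 h2.
Qed.

Lemma w_arrow_id m n (mn : m <= n) M : m < n ->
  let c := w_ext mn (idm M) in
  c.1 \oc (w_ext (lexx m) (idm M)).1 = c.1 /\
  c.2 \oc (w_ext (lexx m) (idm M)).2 = c.2.
Proof.
move=> lt_mn c.
have h := wd_morphism_comp (w_extP (lexx m) (idm M)) (w_extP mn (idm M)).
rewrite comp1m in h; have := wd_morphism_uniq lt_mn h (w_extP mn (idm M)).
by rewrite [RHS]surjective_pairing => -[].
Qed.

Lemma w_arrow_comp m n (mn : m <= n) M M' M'' (g : Hom M' M'') (f : Hom M M') :
  m < n ->
  let c := w_ext mn (idm M'') in
  let e M M' (f : Hom M M') := w_ext (lexx m) f in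
  c.1 \oc (e _ _ (g \oc f)).1 = c.1 \oc ((e _ _ g).1 \oc (e _ _ f).1) /\
  c.2 \oc (e _ _ (g \oc f)).2 = c.2 \oc ((e _ _ g).2 \oc (e _ _ f).2).
Proof.
move=> lt_mn c e.
have h1 := wd_morphism_comp (w_extP (lexx m) (g \oc f)) (w_extP mn (idm M'')).
have h2 := wd_morphism_comp
  (wd_morphism_comp (w_extP (lexx m) f) (w_extP (lexx m) g))
  (w_extP mn (idm M'')).
by have [-> ->] := wd_morphism_uniq lt_mn h1 h2.
Qed.

Lemma w_arrow_add m n (mn : m <= n) M M' (f g : Hom M M') : m < n ->
  let c := w_ext mn (idm M') in
  let e (f : Hom M M') := w_ext (lexx m) f in
  c.1 \oc (e (f + g)).1 = c.1 \oc ((e f).1 + (e g).1) /\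
  c.2 \oc (e (f + g)).2 = c.2 \oc ((e f).2 + (e g).2).
Proof.
move=> lt_mn c e.
have h1 := wd_morphism_comp (w_extP (lexx m) (f + g)) (w_extP mn (idm M')).
have h2 := wd_morphism_comp
  (wd_morphismD (w_extP (lexx m) f) (w_extP (lexx m) g))
  (w_extP mn (idm M')).
by have [-> ->] := wd_morphism_uniq lt_mn h1 h2.
Qed.

Section Arrows.
Variables (m n : int) (mn : m < n).

(* The connecting morphisms w_{<= m} M -> w_{<= n} M and
   w_{>= m+1} M -> w_{>= n+1} M; they are unique by wd_morphism_uniq.  The
   extension of f : M -> M' to the m-weight decompositions is only a choice,
   but its composite with the connecting morphism is unique. *)
Definition w_le_arrow : weak_arrow C :=
  @WeakArrow C (fun M => wd_L (wdec m M)) (fun M => wd_L (wdec n M))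
    (fun M => (w_ext (ltW mn) (idm M)).1)
    (fun M M' f => (w_ext (lexx m) f).1) (fun M M' f => (w_ext (lexx n) f).1)
    (fun M M' f => proj1 (w_arrow_square (ltW mn) f mn))
    (fun M => proj1 (w_arrow_id (ltW mn) M mn))
    (fun M M' M'' g f => proj1 (w_arrow_comp (ltW mn) g f mn))
    (fun M M' f g => proj1 (w_arrow_add (ltW mn) f g mn)).

Definition w_ge_arrow : weak_arrow C :=
  @WeakArrow C (fun M => wd_R (wdec m M)) (fun M => wd_R (wdec n M))
    (fun M => (w_ext (ltW mn) (idm M)).2)
    (fun M M' f => (w_ext (lexx m) f).2) (fun M M' f => (w_ext (lexx n) f).2)
    (fun M M' f => proj2 (w_arrow_square (ltW mn) f mn))
    (fun M => proj2 (w_arrow_id (ltW mn) M mn))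
    (fun M M' M'' g f => proj2 (w_arrow_comp (ltW mn) g f mn))
    (fun M M' f g => proj2 (w_arrow_add (ltW mn) f g mn)).

End Arrows.

Fact tau_le_lt n : n < n + 1.
Proof. by rewrite ltzD1. Qed.

Fact tau_ge_lt n : n - 1 - 1 < n - 1.
Proof. by rewrite -{2}(subrK 1 (n - 1)) ltzD1. Qed.

(* Im (H (w_{<= n+1} M) -> H (w_{<= n} M)) *)
Definition tau_le n (H : presheaf C) : presheaf C :=
  im_presheaf (w_le_arrow (tau_le_lt n)) H.

(* Im (H (w_{>= n} M) -> H (w_{>= n-1} M)), where w_{>= i} M is the right-hand
   term of the (i - 1)-weight decomposition. *)
Definition tau_ge n (H : presheaf C) : presheaf C :=
  im_presheaf (w_ge_arrow (tau_ge_lt n)) H.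

End WeightFacts.

(* Main.v *)
From HB Require Import structures.
From mathcomp Require Import all_boot all_order all_algebra.
From mathcomp Require Import boolp.
Require Import Defs.

(* All four conditions say that every N in C' lies in a triangle L -> N -> R
   with C_{w<=i} orthogonal to L and C_{w>=i+1} orthogonal to R, for one i or,
   after shifting, for all i.  Given such a triangle, comparing H_N with H_L and
   H_R on the weight decompositions identifies H_L with tau_{>=i+1} H_N and H_R
   with tau_{<=i} H_N.  Conversely, if L represents tau_{>=i+1} H_N, then the
   natural map tau_{>=i+1} H_N -> H_N is induced by a morphism L -> N because C
   reflects C'; it is surjective on C_{w>=i+1} and injective on C_{w>=i}, so
   its cone is right orthogonal to C_{w>=i+1}.  The case of tau_{<=i} is dual.
   The t-structure consists of the objects right orthogonal to C_{w<=-1} and to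
   C_{w>=1}; its orthogonality axiom holds since a morphism of C' that vanishes
   on all objects of C is zero. *)

Set Implicit Arguments.
Unset Strict Implicit.
Unset Printing Implicit Defensive.

Import Order.TTheory GRing.Theory Num.Theory.
Local Open Scope ring_scope.
Local Open Scope cat_scope.

(** * Consequences of the long exact Hom sequences of a distinguished triangle *)

Section Triangles.
Variable D : tricat.
Implicit Types X Y Z M : D.

Lemma dist_comp0 X Y Z (f : Hom X Y) (g : Hom Y Z) (h : Hom Z (shift X)) :
  dist f g h -> g \oc f = 0.
Proof.
move=> fgh; have [O O0] := tzero D.
have [c [e _]] := dist_map (dist_id X O0) fgh (erefl (f \oc idm X)).
by rewrite -e compm0.
Qed.

Lemma dist_comp0r X Y Z (f : Hom X Y) (g : Hom Y Z) (h : Hom Z (shift X)) :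
  dist f g h -> h \oc g = 0.
Proof. by move=> /dist_rot/dist_comp0. Qed.

(** Exactness of Hom(M[1], -): the connecting map sends Hom(M[1], Z) into the kernel of f on
    Hom(M[1], X[1]) = Hom(M, X), which is zero, so u comes from Y, hence from X. Using M and M[1]
    instead of M[-1] avoids [unshift]. *)
Lemma dist_third_orth X Y Z (f : Hom X Y) (g : Hom Y Z) (h : Hom Z (shift X))
    M :
  dist f g h ->
  (forall x : Hom (shift M) Y, exists y, x = f \oc y) ->
  (forall v : Hom M X, f \oc v = 0 -> v = 0) ->
  forall u : Hom (shift M) Z, u = 0.
Proof.
move=> fgh f_surj f_inj u; have ghf := (iffLR (dist_rot _ _ _)) fgh.
have [v hu] := shift_full (h \oc u).
have fv0 : f \oc v = 0.
  apply: shift_inj; rewrite fmapM hu compA.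
  by apply: oppr_inj; rewrite -!compNm (dist_comp0r ghf) comp0m oppr0.
have hu0 : h \oc u = 0 by rewrite -hu (f_inj v fv0) fmap0.
have [x ->] := dist_wker ghf hu0; have [y ->] := f_surj x.
by rewrite compA (dist_comp0 fgh) comp0m.
Qed.

Lemma dist_first_orth X Y Z (f : Hom X Y) (g : Hom Y Z) (h : Hom Z (shift X))
    M :
  dist f g h ->
  (forall x : Hom (shift M) Z, exists y, x = g \oc y) ->
  (forall v : Hom M Y, g \oc v = 0 -> v = 0) ->
  forall u : Hom M X, u = 0.
Proof.
move=> /dist_rot ghf g_surj g_inj u; apply: shift_inj.
exact: dist_third_orth ghf g_surj g_inj _.
Qed.

Lemma dist_first_inj X Y Z (f : Hom X Y) (g : Hom Y Z) (h : Hom Z (shift X)) M :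
  dist f g h -> (forall u : Hom (shift M) Z, u = 0) ->
  forall v : Hom M X, f \oc v = 0 -> v = 0.
Proof.
move=> fgh MZ v fv0; apply: shift_inj.
have /dist_rot hfg := (iffLR (dist_rot _ _ _)) fgh.
have Sfv0 : - fmap shift f \oc fmap shift v = 0.
  by rewrite compNm -fmapM fv0 fmap0 oppr0.
by have [u ->] := dist_wker hfg Sfv0; rewrite [u]MZ compm0.
Qed.

(** The obstruction to extending u along f is the composite of h with u[1], a morphism Z -> W[1]. *)
Lemma dist_first_extend X Y Z (f : Hom X Y) (g : Hom Y Z)
    (h : Hom Z (shift X)) W (u : Hom X W) :
  dist f g h -> (forall v : Hom Z (shift W), v = 0) ->
  exists y : Hom Y W, u = y \oc f.
Proof.
move=> fgh ZW; have /dist_rot hfg := (iffLR (dist_rot _ _ _)) fgh.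
have [v Su] := dist_wcoker hfg (ZW (fmap shift u \oc h)).
have [y vy] := shift_full (- v); exists y.
apply/eqP; rewrite -subr_eq0; apply/eqP/shift_inj.
by rewrite fmapB fmapM vy Su compNm compmN subrr.
Qed.

Lemma dist_fiber Y Z (g : Hom Y Z) :
  exists (X : D) (f : Hom X Y) (h : Hom Z (shift X)), dist f g h.
Proof.
have [Q [k [q gkq]]] := dist_cone g; have [v [vK Kv]] := unshiftK_iso Q.
(* The sign cancels the one that [dist_rot] puts on f[1]. *)
have [f Sf] := shift_full (- (q \oc unshiftK Q)).
exists (unshift Q), f, (v \oc k); apply/dist_rot; rewrite Sf opprK.
apply: (dist_iso (a := idm _) (b := idm _) (c := v)) gkq.
- exact: is_iso_id.
- exact: is_iso_id.
- by exists (unshiftK Q).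
- by rewrite comp1m compm1.
- by rewrite compm1.
- by rewrite fmap1 comp1m -compA Kv compm1.
Qed.

End Triangles.

(** * Right orthogonals of shifted classes *)

Section Orthogonal.
Variables (D : tricat) (C : trisub D).
Implicit Types (A : cls (fullsub C)) (N : D).

(** N ranges over all of D, so that the notion serves the objects of C' as well as the weight
    truncations, which lie in C. *)
Definition perp A N :=
  forall M : fullsub C, A M -> forall f : @Hom D (sval M) N, f = 0.

Lemma perp_iso A N N' : isomorphic N N' -> perp A N -> perp A N'.
Proof.
move=> NN' pN M AM; apply: (orth_iso (isomorphic_refl (sval M)) NN').
exact: pN.
Qed.

Lemma perp_sub A A' N : (forall M, A M -> A' M) -> perp A' N -> perp A N.
Proof. by move=> AA' pN M /AA'; apply: pN. Qed.

Lemma perp_of_shift A m N :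
  (forall M : fullsub C, shiftcls A m M ->
     forall f : @Hom D (shift (sval M)) N, f = 0) ->
  perp (shiftcls A (m + 1)) N.
Proof.
move=> pN M AM; have [M0 [AM0 MM]] := shiftclsSE AM.
apply: (orth_iso (X := shift (sval M0)) MM (isomorphic_refl _)); exact: pN.
Qed.

Lemma perp_shift A m N :
  perp (shiftcls A (m + 1)) (shift N) <-> perp (shiftcls A m) N.
Proof.
split=> pN; last apply: perp_of_shift; move=> M AM f.
  apply: shift_inj; apply: (pN (@shift (fullsub C) M)); exact: shiftclsS.
by have [g <-] := shift_full f; rewrite (pN _ AM g) fmap0.
Qed.

(** Since [shift] is an equivalence, [perp_shift] moves both sides of the orthogonality at once, one
    step at a time. This identifies the shifts of the two classes of the t-structure. *)
Lemma shiftcls_perp (C' : trisub D) A m i (N : fullsub C') :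
  shiftcls (fun N : fullsub C' => perp (shiftcls A m) (sval N)) i N <->
  perp (shiftcls A (m + i)) (sval N).
Proof.
set K := fun N : fullsub C' => _; elim/int_step: i N => [|i IH|i IH] N.
- rewrite addr0; split=> [[X [KX XN]]|KN]; first exact: perp_iso XN KX.
  by exists N; split=> //; apply: isomorphic_refl.
- rewrite addrA; split=> [/shiftclsSE[N0 [/IH pN0 N0N]]|pN].
    by apply: (perp_iso N0N); apply/perp_shift.
  have NN : isomorphic (shift (unshift N)) N.
    by exists (unshiftK N); apply: unshiftK_iso.
  have /IH[X [KX XN]] : perp (shiftcls A (m + i)) (sval (unshift N)).
    apply/perp_shift; exact: perp_iso (isomorphic_sym NN) pN.
  exists X; split=> //.
  apply: isomorphic_trans (isomorphic_sym (shiftzS i X)) _.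
  exact: isomorphic_trans (functor_isomorphic shift XN) NN.
- rewrite -perp_shift -addrA -(IH (shift N)); split=> [/shiftclsS//|].
  move=> /shiftclsSE[N0 [[X [KX XN0]] /isomorphic_shift N0N]].
  by exists X; split=> //; apply: isomorphic_trans N0N.
Qed.

End Orthogonal.

Lemma w_geS (C : tricat) (w : weight_structure C) m M :
  w_ge w (m + 1) M -> w_ge w m M.
Proof.
move=> [X [wX XM]]; exists (shift X); split.
  by apply: wge0_shift; exists X; split=> //; apply: isomorphic_refl.
apply: isomorphic_trans (shiftzA m X) _.
exact: isomorphic_trans (shiftzS m X) XM.
Qed.

(** * Morphisms of presheaves given by their graphs *)

Section GraphIso.
Variables (C : preadditive) (F G : presheaf C).
Variable S : forall M : C, F M -> G M -> Prop.
Hypothesis SB : forall M (x x' : F M) (y y' : G M),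
  S x y -> S x' y' -> S (x - x') (y - y').
Hypothesis S_nat : forall M M' (f : Hom M M') (x : F M') (y : G M'),
  S x y -> S (pmap F f x) (pmap G f y).
Hypothesis S_total : forall M (x : F M), exists y : G M, S x y.
Hypothesis S_func : forall M (y : G M), S 0 y -> y = 0.

Lemma graph_uniq M (x : F M) (y y' : G M) : S x y -> S x y' -> y = y'.
Proof.
move=> Sxy Sxy'; apply/eqP; rewrite -subr_eq0; apply/eqP/S_func.
by rewrite -(subrr x); apply: SB.
Qed.

(** Elements of an image have no canonical lift, so maps out of a truncation are easier to give as
    relations. By [SB] and [S_func] the relation is single-valued, which makes the chosen values
    additive and natural. *)
Lemma graph_nat_trans :
  exists a : nat_trans F G, forall M x y, a M x = y <-> S x y.
Proof.
pose phi M (x : F M) : G M := sval (cid (S_total x)).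
have phiP M (x : F M) : S x (phi M x) by rewrite /phi; case: cid.
have phi_add M : zmod_morphism (phi M).
  move=> x y; apply: graph_uniq (phiP M (x - y)) _; exact: SB.
pose a M : {additive F M -> G M} :=
  HB.pack (phi M) (GRing.isZmodMorphism.Build _ _ (phi M) (phi_add M)).
have a_nat M M' (f : Hom M M') (y : F M') :
    a M (pmap F f y) = pmap G f (a M' y).
  apply: graph_uniq (phiP M _) _; exact: S_nat.
exists (NatTrans a_nat) => M x y; split=> [<-|Sxy]; first exact: phiP.
exact: graph_uniq (phiP M x) Sxy.
Qed.

End GraphIso.

(** The relation and its converse each define a transformation; having opposite graphs, the two are
    mutually inverse. *)
Lemma graph_presheaf_iso (C : preadditive) (F G : presheaf C)
    (S : forall M : C, F M -> G M -> Prop) :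
  (forall M (x x' : F M) (y y' : G M),
     S M x y -> S M x' y' -> S M (x - x') (y - y')) ->
  (forall M M' (f : Hom M M') (x : F M') (y : G M'),
     S M' x y -> S M (pmap F f x) (pmap G f y)) ->
  (forall M (x : F M), exists y, S M x y) ->
  (forall M (y : G M), exists x, S M x y) ->
  (forall M (y : G M), S M 0 y -> y = 0) ->
  (forall M (x : F M), S M x 0 -> x = 0) ->
  presheaf_iso F G.
Proof.
move=> SB S_nat S_total S_cototal S_func S_inj.
have [a aE] := graph_nat_trans SB S_nat S_total S_func.
have [b bE] := @graph_nat_trans _ G F (fun M y x => S M x y)
  (fun M _ _ _ _ => @SB M _ _ _ _) (fun M M' f _ _ => @S_nat M M' f _ _)
  S_cototal S_inj.
by exists a, b; split=> M x; [apply/bE/aE | apply/aE/bE].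
Qed.

Definition nt_comp (C : preadditive) (F G K : presheaf C)
    (a : nat_trans G K) (b : nat_trans F G) : nat_trans F K.
Proof.
refine (@NatTrans _ F K (fun M => a M \o b M) _) => M M' f y /=.
by rewrite !nt_nat.
Defined.

(** * Virtual t-truncations of H_N compared with triangles on N *)

Section Truncations.
Variables (D : tricat) (C : trisub D) (w : weight_structure (fullsub C)).
Implicit Types (M : fullsub C) (N : D).

(** The weight decompositions are viewed in D, where they have morphisms to objects outside C. *)
Let wL m M : D := sval (wd_L (wdec w m M)).
Let wR m M : D := sval (wd_R (wdec w m M)).
Let wl m M : @Hom D (wL m M) (sval M) := wd_l (wdec w m M).
Let wr m M : @Hom D (sval M) (wR m M) := wd_r (wdec w m M).
Let wh m M : @Hom D (wR m M) (shift (wL m M)) := wd_h (wdec w m M).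

Let w_dist m M : @dist D _ _ _ (wl m M) (wr m M) (wh m M).
Proof. exact: (wd_dist (wdec w m M)). Qed.

Let perp_wL m N (pN : perp (w_le w m) N) M (u : Hom (wL m M) N) : u = 0.
Proof. exact: (pN _ (wd_le (wdec w m M))). Qed.

Let perp_wR m N (pN : perp (w_ge w (m + 1)) N) M (u : Hom (wR m M) N) : u = 0.
Proof. exact: (pN _ (wd_ge (wdec w m M))). Qed.

Let perp_le_wR m M : perp (w_le w m) (wR m M).
Proof. by move=> X wX; apply: w_orth1 wX (wd_ge (wdec w m M)). Qed.

Let wl0 m M : w_ge w (m + 1) M -> wl m M = 0.
Proof. move=> wM; exact: (w_orth1 (wd_le (wdec w m M)) wM). Qed.

Let wr0 m M : w_le w m M -> wr m M = 0.
Proof. by move=> wM; apply: (perp_le_wR wM). Qed.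

Section Consecutive.
Variables (m n : int) (mn : m < n).
(** An equation rather than a substitution: [tau_le] takes the pair n, n + 1, but [tau_ge] takes n -
    1 - 1, n - 1, where the larger index is not literally a successor. *)
Hypothesis nE : n = m + 1.

Let cL M : @Hom D (wL m M) (wL n M) := wa_arr (w_le_arrow w mn) M.
Let cR M : @Hom D (wR m M) (wR n M) := wa_arr (w_ge_arrow w mn) M.
Let eL M M' (f : Hom M M') : @Hom D (wL m M) (wL m M') :=
  wa_fsrc (w_le_arrow w mn) f.
Let eR M M' (f : Hom M M') : @Hom D (wR m M) (wR m M') :=
  wa_fsrc (w_ge_arrow w mn) f.

Let cLE M : wl n M \oc cL M = wl m M.
Proof.
have [e _ _] := w_extP w (ltW mn) (idm M); rewrite [LHS]e; exact: comp1m.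
Qed.

Let cRE M : cR M \oc wr m M = wr n M.
Proof.
have [_ e _] := w_extP w (ltW mn) (idm M); rewrite [LHS]e; exact: compm1.
Qed.

Let eL_nat M M' (f : Hom M M') : wl m M' \oc eL f = (f : @Hom D _ _) \oc wl m M.
Proof. by have [e _ _] := w_extP w (lexx m) f. Qed.

Let eR_nat M M' (f : Hom M M') : eR f \oc wr m M = wr m M' \oc (f : @Hom D _ _).
Proof. by have [_ e _] := w_extP w (lexx m) f. Qed.

(** A morphism killed by [wr m M] factors through the shift of [wL m M], which lies in w <= m + 1 =
    n. *)
Let wR_precomp0 M N : perp (w_le w n) N ->
  forall u : Hom (wR m M) N, u \oc wr m M = 0 -> u = 0.
Proof.
move=> pN u /(dist_wcoker2 (w_dist m M))[t ->].
have sL := shiftclsS (wd_le (wdec w m M)); rewrite -nE in sL.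
by rewrite [t](pN _ sL) comp0m.
Qed.

Let wR_eq M (u u' : Hom (wR m M) (wR n M)) :
  u \oc wr m M = u' \oc wr m M -> u = u'.
Proof.
move=> e; apply/eqP; rewrite -subr_eq0.
apply/eqP/(wR_precomp0 (@perp_le_wR n M)).
by rewrite compDl compNm e subrr.
Qed.

Let wL_eq M (u u' : Hom (wL m M) (wL n M)) :
  wl n M \oc u = wl n M \oc u' -> u = u'.
Proof.
move=> e; apply/eqP; rewrite -subr_eq0; apply/eqP.
apply: (dist_first_inj (w_dist n M)); last by rewrite compDr compmN e subrr.
have sL := shiftclsS (wd_le (wdec w m M)); rewrite -nE in sL.
exact: (perp_le_wR sL).
Qed.

Section Represent.
Variables (N L R : D) (f : Hom L N) (g : Hom N R) (h : Hom R (shift L)).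
Hypothesis fgh : dist f g h.

(** A morphism [wR n M] -> N lifts to L because R is orthogonal to w >= n + 1; a morphism M -> L
    factors through [wR n M] because L is orthogonal to w <= n. Restricting to [wR m M] removes the
    ambiguity of both choices. *)
Lemma tau_ge_iso : perp (w_le w n) L -> perp (w_ge w (n + 1)) R ->
  presheaf_iso (im_presheaf (w_ge_arrow w mn) (H_ C N)) (H_ C L).
Proof.
move=> pL pR.
(* Neither x nor y is determined by its image in H_ C N M, so they are compared
   through a common lift z. *)
pose S M (x : im_presheaf (w_ge_arrow w mn) (H_ C N) M) (y : H_ C L M) :=
  exists z : @Hom D (wR m M) L, f \oc z = im_val x /\ z \oc wr m M = y.
apply: (@graph_presheaf_iso _ _ _ S).
- move=> M x x' y y' [z [zx zy]] [z' [zx' zy']]; exists (z - z').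
  by rewrite compDr compmN zx zx' compDl compNm zy zy'.
- move=> M M' k x y [z [zx zy]]; exists (z \oc eR k); split.
    by rewrite compA zx.
  by rewrite -compA eR_nat compA zy.
- move=> M x; have [a ax] : exists a, a \oc cR M = im_val x := imP x.
  have [a' aE] := dist_wker fgh (perp_wR pR (g \oc a)).
  by exists (a' \oc cR M \oc wr m M), (a' \oc cR M); rewrite compA -aE.
- move=> M y.
  have [a' yE] := dist_wcoker (w_dist n M)
    (perp_wL pL ((y : Hom (sval M) L) \oc wl n M)).
  have mem : (f \oc a' \oc cR M) \in
      im_pred (pmap (H_ C N) (wa_arr (w_ge_arrow w mn) M)).
    exact: (@mem_im _ _ (pmap (H_ C N) (wa_arr (w_ge_arrow w mn) M))
      (f \oc a')).
  exists (Defs.Im mem), (a' \oc cR M); split; first by rewrite compA.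
  by rewrite -compA cRE -yE.
(* The lift z is determined by x: its ambiguity comes from morphisms [wR m M][1] -> R, and the
   source lies in w >= n + 1. Below, y determines z by [wR_precomp0]. *)
- move=> M y [z [fz0 <-]]; rewrite (_ : z = 0) ?comp0m //.
  apply: (dist_first_inj fgh) fz0 => u.
  have sR := shiftclsS (wd_ge (wdec w m M)).
  by rewrite -nE in sR; exact: (pR _ sR u).
- move=> M x [z [zx zr0]]; apply: val_inj; rewrite /= -zx.
  by rewrite (wR_precomp0 pL zr0) compm0.
Qed.

(** Here both sides embed into Hom([wL m M], R), by g and by restriction along [wl m M], and [S] is
    equality there. The two images agree because a morphism [wL n M] -> N -> R extends to M, while a
    restriction to [wL n M] of a morphism M -> R lifts to N. *)
Lemma tau_le_iso : perp (w_le w m) L -> perp (w_ge w (m + 1)) R ->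
  presheaf_iso (im_presheaf (w_le_arrow w mn) (H_ C N)) (H_ C R).
Proof.
move=> pL pR.
pose S M (x : im_presheaf (w_le_arrow w mn) (H_ C N) M) (y : H_ C R M) :=
  g \oc (im_val x : Hom (wL m M) N) = (y : Hom (sval M) R) \oc wl m M.
apply: (@graph_presheaf_iso _ _ _ S).
- move=> M x x' y y' Sxy Sxy'.
  by rewrite /S /= compDr compmN Sxy Sxy' compDl compNm.
- move=> M M' k x y Sxy; rewrite /S /=.
  rewrite [LHS](compA g (im_val x : Hom (wL m M') N) (eL k)) Sxy.
  by rewrite -compA eL_nat compA.
- move=> M x; have [a ax] : exists a, a \oc cL M = im_val x := imP x.
  have [v|y gaE] := dist_first_extend (g \oc a) (w_dist n M).
    by apply: perp_wR v; rewrite nE; apply/perp_shift.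
  by exists y; rewrite /S -ax compA gaE -compA cLE.
- move=> M y.
  have [||a yE] := @dist_wker D _ _ _ g h (- fmap shift f) (wL n M)
    ((y : Hom (sval M) R) \oc wl n M).
  + exact: (iffLR (dist_rot _ _ _)).
  + by apply: perp_wL; rewrite nE; apply/perp_shift.
  have mem : a \oc cL M \in
      im_pred (pmap (H_ C N) (wa_arr (w_le_arrow w mn) M)).
    exact: (@mem_im _ _ (pmap (H_ C N) (wa_arr (w_le_arrow w mn) M)) a).
  by exists (Defs.Im mem); rewrite /S /= compA -yE -compA cLE.
- move=> M y; rewrite /S /= compm0 => /esym yl0.
  have [v ->] := dist_wcoker (w_dist m M) yl0.
  by rewrite [v](perp_wR pR) comp0m.
- move=> M x; rewrite /S /= comp0m => gx0; apply: val_inj => /=.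
  have [v ->] := dist_wker fgh gx0.
  by rewrite [v](perp_wL pL) compm0.
Qed.

End Represent.

Section Triangle.
Variables (C' : trisub D) (N : fullsub C').
Hypothesis reflC : reflects C C'.

(** For i = -1 this is the decomposition of N for the t-structure sought: L in t >= 0 and R in t <=
    -1. *)
Definition adjacent_triangle i := exists (L R : fullsub C')
    (f : Hom L N) (g : Hom N R) (h : Hom R (shift L)),
  [/\ dist f g h, perp (w_le w i) (sval L) & perp (w_ge w (i + 1)) (sval R)].

Let H := H_ C (sval N).

Lemma tau_ge_triangle :
  representable_in C' (im_presheaf (w_ge_arrow w mn) H) -> adjacent_triangle n.
Proof.
set T := im_presheaf _ _; move=> [L [a [b [ba ab]]]].
(* The natural map from the truncation to H; [f] is the morphism of C' that induces it on
   representing objects. *)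
pose phi M (x : T M) : H M := im_val x \oc wr m M.
have phi_add M : zmod_morphism (@phi M).
  by move=> x y; rewrite /phi /= compDl compNm.
pose phiA M : {additive T M -> H M} :=
  HB.pack (@phi M) (GRing.isZmodMorphism.Build _ _ (@phi M) (@phi_add M)).
have phi_nat M M' (k : Hom M M') (x : T M') :
    phiA M (pmap T k x) = pmap H k (phiA M' x).
  rewrite /= /phi /=.
  rewrite [LHS](esym (compA (im_val x : Hom (wR m M') (sval N)) (eR k)
    (wr m M))).
  by rewrite eR_nat compA.
have [f fE] := (reflC L N).2 (nt_comp (NatTrans phi_nat) b).
have {}fE M (x : Hom (sval M) (sval L)) : f \oc x = phi M (b M x) := fE M x.
have [R [g [h fgh]]] := @dist_cone (fullsub C') L N f.
exists L, R, f, g, h; split=> // [M wM x|].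
  (* The truncation vanishes on w <= n: there [wr n M] = 0, which forces [cR M] = 0. *)
  have bx0 : b M x = 0.
    apply: val_inj; rewrite /=.
    have [u <-] : exists u, u \oc cR M = im_val (b M x) := imP (b M x).
    suff -> : cR M = 0 by rewrite compm0.
    by apply: wR_eq; rewrite cRE wr0 // comp0m.
  by rewrite -[x]ab bx0 raddf0.
(* For M in w >= n it remains to see that [phi] is surjective at M[1], which is in w >= n + 1, and
   injective at M. *)
apply: perp_of_shift => M wM.
apply: (@dist_third_orth D _ _ _ f g h (sval M) fgh).
  move=> x; have wSM := shiftclsS wM; pose SM := @shift (fullsub C) M.
  have [|u xE] := @dist_wcoker D _ _ _ _ _ _ _ x (w_dist n SM).
    by rewrite [wl n SM]wl0 ?compm0.
  have mem : u \oc cR SM \in im_pred (pmap H (wa_arr (w_ge_arrow w mn) SM)).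
    exact: (@mem_im _ _ (pmap H (wa_arr (w_ge_arrow w mn) SM)) u).
  exists (a SM (Defs.Im mem)); rewrite (fE SM) ba /phi.
  by rewrite [RHS](esym (compA u (cR SM) (wr m SM))) cRE.
move=> v; rewrite fE => phi0; rewrite -[v]ab.
suff -> : b M v = 0 by rewrite raddf0.
have [u uE] : exists u, u \oc cR M = im_val (b M v) := imP (b M v).
move: phi0; rewrite /phi -uE -compA cRE => ur0.
rewrite nE in wM.
(* As [wl m M] = 0, [wr m M] has a retraction s, and the connecting morphism is then [wr n M] after
   s; so u is killed by [cR M] once it is killed by [wr n M]. *)
have [|s sE] := @dist_wcoker D _ _ _ _ _ _ _ (idm (sval M)) (w_dist m M).
  by rewrite wl0 ?compm0.
apply: val_inj; rewrite /= -uE.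
have -> : cR M = wr n M \oc s.
  by apply: wR_eq; rewrite cRE -compA -sE compm1.
by rewrite compA ur0 comp0m.
Qed.

Lemma tau_le_triangle :
  representable_in C' (im_presheaf (w_le_arrow w mn) H) -> adjacent_triangle m.
Proof.
set T := im_presheaf _ _; move=> [R [a [b [ba ab]]]].
have mem M (u : Hom (wL n M) (sval N)) :
    u \oc cL M \in im_pred (pmap H (wa_arr (w_le_arrow w mn) M)).
  exact: (@mem_im _ _ (pmap H (wa_arr (w_le_arrow w mn) M)) u).
(* Dually, the natural map from H to the truncation is restriction along [wl m M], which passes
   through [wL n M] and so lands in the image. *)
pose psi M (x : H M) : T M :=
  Defs.Im (mem M ((x : Hom (sval M) (sval N)) \oc wl n M)).
have psiE M x : im_val (psi M x) = x \oc wl m M by rewrite /= -compA cLE.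
have psi_add M : zmod_morphism (@psi M).
  by move=> x y; apply: val_inj; rewrite /= !compDl !compNm.
pose psiA M : {additive H M -> T M} :=
  HB.pack (@psi M) (GRing.isZmodMorphism.Build _ _ (@psi M) (@psi_add M)).
have psi_nat M M' (k : Hom M M') (x : H M') :
    psiA M (pmap H k x) = pmap T k (psiA M' x).
  apply: val_inj; rewrite [LHS]psiE.
  transitivity ((im_val (psi M' x) : Hom (wL m M') (sval N)) \oc eL k);
    last by [].
  by rewrite psiE -compA eL_nat compA.
have [g gE] := (reflC N R).2 (nt_comp a (NatTrans psi_nat)).
have {}gE M (x : Hom (sval M) (sval N)) : g \oc x = a M (psi M x) := gE M x.
have [L [f [h fgh]]] := @dist_fiber (fullsub C') N R g.
exists L, R, f, g, h; split=> // M wM; last first.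
  move=> x; have bx0 : b M x = 0.
    apply: val_inj; rewrite /=.
    have [u <-] : exists u, u \oc cL M = im_val (b M x) := imP (b M x).
    suff -> : cL M = 0 by rewrite compm0.
    by apply: wL_eq; rewrite cLE wl0 // compm0.
  by rewrite -[x]ab bx0 raddf0.
apply: (@dist_first_orth D _ _ _ f g h (sval M) fgh).
  move=> x; pose SM := @shift (fullsub C) M.
  have wSM : w_le w n SM by rewrite nE; apply: shiftclsS.
  have [u uE] : exists u, u \oc cL SM = im_val (b SM x) := imP (b SM x).
  (* As [wr n SM] = 0, s is a section of [wl n SM], so u composed with s is a preimage defined on
     the whole of M[1]. *)
  have [|s sE] := @dist_wker D _ _ _ _ _ _ _ (idm (sval SM)) (w_dist n SM).
    by rewrite wr0 ?comp0m.
  exists (u \oc s); rewrite (gE SM) -[LHS](ab SM x); congr (a SM _).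
  apply: val_inj; rewrite /= -uE [RHS]psiE -compA; congr (_ \oc _).
  by apply: wL_eq; rewrite cLE compA -sE comp1m.
move=> v; rewrite gE => a0.
have : psi M v = 0 by rewrite -[psi M v]ba a0 raddf0.
move=> /(congr1 (@im_val _ _ _)); rewrite psiE /= => vl0.
have [|s sE] := @dist_wker D _ _ _ _ _ _ _ (idm (sval M)) (w_dist m M).
  by rewrite wr0 ?comp0m.
by rewrite -[v]compm1 sE compA vl0 comp0m.
Qed.

End Triangle.
End Consecutive.
End Truncations.

(** * Adjacent triangles and the orthogonal t-structure *)

Section AdjacentTStructure.
Variables (D : tricat) (C C' : trisub D) (w : weight_structure (fullsub C)).
Implicit Types (N : fullsub C') (i : int).

(** To raise the index, shift a triangle on N[-1]; to lower it, unshift one on N[1]. *)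
Lemma adjacent_triangle_shift i :
  (forall N, adjacent_triangle w N i) <->
  (forall N, adjacent_triangle w N (i + 1)).
Proof.
have SU N : isomorphic (shift (unshift N)) N.
  by exists (unshiftK N); apply: unshiftK_iso.
split=> adj N.
  have [L [R [f [g [h [fgh pL pR]]]]]] := adj (unshift N).
  have [f' [g' [h' fgh']]] := @dist_ends_iso (fullsub C') _ _ _ _ _ _ _ _ _
    (iffLR (dist_shift _ _ _) fgh) (isomorphic_refl _) (SU N)
    (isomorphic_refl _).
  exists (shift L), (shift R), f', g', h'; split=> //.
    by apply/(perp_shift (wle0 w)).
  by apply/(perp_shift (wge0 w)).
have [L [R [f [g [h [fgh pL pR]]]]]] := adj (shift N).
have [f1 [g1 [h1 d1]]] := @dist_ends_iso (fullsub C') _ _ _ _ _ _ _ _ _ fgh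
  (isomorphic_sym (SU L)) (isomorphic_refl _) (isomorphic_sym (SU R)).
have [f' ef] := shift_full f1; have [g' eg] := shift_full g1.
have [h' eh] := shift_full (- h1).
exists (unshift L), (unshift R), f', g', h'; split.
- by apply/(@dist_shift (fullsub C')); rewrite ef eg eh opprK.
- apply/(perp_shift (wle0 w)); apply: perp_iso pL.
  exact: isomorphic_sym (SU L).
- apply/(perp_shift (wge0 w)); apply: perp_iso pR.
  exact: isomorphic_sym (SU R).
Qed.

Lemma adjacent_triangle_all i0 : (forall N, adjacent_triangle w N i0) ->
  forall i N, adjacent_triangle w N i.
Proof.
move=> adj i; rewrite -(subrK i0 i); elim/int_step: (i - i0) => [|j IH|j IH].
- by rewrite add0r.
- by rewrite addrAC -adjacent_triangle_shift.
- by rewrite adjacent_triangle_shift addrAC.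
Qed.

Lemma orth_inD (A : cls (fullsub C)) (B : cls (fullsub C')) :
  @orth D (inD A) (inD B) <->
  forall N, B N -> perp A (sval N).
Proof.
split=> [o N BN M AM|o X Y [CX AX] [CY BY]]; last exact: (o _ BY _ AX).
move: M N AM BN => [M PM] [N PN] AM BN.
by apply: (o M N); [exists PM|exists PN].
Qed.

Lemma t_structure_adjacent_triangle (t : t_structure (fullsub C')) N :
  right_orthogonal w t -> adjacent_triangle w N (-1).
Proof.
move=> [/orth_inD ge_perp /orth_inD le_perp].
have [L [R [f [g [h [tL tR fgh]]]]]] := t_decomp t N.
exists L, R, f, g, h; split=> //; last exact: le_perp.
(* Orthogonality is given between w <= 0 and t >= 1, but needed between w <= -1 and t >= 0. *)
apply/(perp_shift (wle0 w)); apply: (ge_perp (shift L)).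
rewrite /t_ge -[1]add0r.
by apply: shiftclsS; exists L; split=> //; apply: isomorphic_refl.
Qed.

Section TStructure.
Hypothesis reflC : reflects C C'.
Hypothesis adj : forall N, adjacent_triangle w N (-1).

(** These are the largest classes that right orthogonality to w allows. *)
Let ge0 N := perp (w_le w (-1)) (sval N).
Let le0 N := perp (w_ge w 1) (sval N).

Let ge0_iso : iso_closed ge0.
Proof. by move=> N N' pN NN'; apply: perp_iso pN; apply: NN'. Qed.

Let le0_iso : iso_closed le0.
Proof. by move=> N N' pN NN'; apply: perp_iso pN; apply: NN'. Qed.

Let le0_shift N : le0 N -> shiftcls le0 1 N.
Proof.
move=> pN; apply/(shiftcls_perp (wge0 w)); apply: perp_sub pN => M.
exact: w_geS.
Qed.

Let ge0_shift N : shiftcls ge0 1 N -> ge0 N.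
Proof.
move=> /(shiftcls_perp (wle0 w)) pN; apply: perp_sub pN => M.
exact: w_leS.
Qed.

(** Faithfulness reduces the claim to composites M -> X -> Y with M in C. Since X is orthogonal to w
    <= 0, M -> X factors through the w >= 1 part of M, to which Y is orthogonal. *)
Let ge1_le0_orth : orth (shiftcls ge0 1) le0.
Proof.
move=> X Y /(shiftcls_perp (wle0 w)) pX pY f.
apply: (reflC X Y).1 => M x /=.
rewrite [RHS](@comp0m D) /=.
have [[L R l r h wL wR lrh]] := wdecomp_exists w 0 M.
have [y xE] := @dist_wcoker D _ _ _ _ _ _ _ x lrh (pX _ wL _).
have fy0 : (f : @Hom D _ _) \oc y = 0 := pY _ wR _.
by rewrite xE [LHS](@compA D) fy0 (@comp0m D).
Qed.

Let decomp N : exists (L R : fullsub C')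
    (f : Hom L N) (g : Hom N R) (h : Hom R (shift L)),
  [/\ ge0 L, shiftcls le0 (-1) R & dist f g h].
Proof.
have [L [R [f [g [h [fgh pL pR]]]]]] := adj N.
by exists L, R, f, g, h; split=> //; apply/(shiftcls_perp (wge0 w)).
Qed.

Lemma adjacent_t_structure :
  exists t : t_structure (fullsub C'), right_orthogonal w t.
Proof.
exists (TStructure le0_iso ge0_iso le0_shift ge0_shift ge1_le0_orth decomp).
by split; apply/orth_inD => N /shiftcls_perp.
Qed.

End TStructure.
End AdjacentTStructure.

Theorem theorem2p2p6 (D : tricat) (C C' : trisub D)
    (w : weight_structure (fullsub C)) (reflC : reflects C C') :
  [<-> exists t : t_structure (fullsub C'), right_orthogonal w t;
       forall M' : fullsub C',
         representable_in C' (tau_ge w 0 (H_ C (sval M')));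
       forall M' : fullsub C',
         representable_in C' (tau_le w (-1) (H_ C (sval M')));
       forall (M' : fullsub C') (i : int),
         representable_in C' (tau_ge w i (H_ C (sval M'))) /\
         representable_in C' (tau_le w i (H_ C (sval M')))].
Proof.
(* Triangles of a single index already give (iv), so each implication only has to produce or use
   them. *)
have rep_ge i : (forall N : fullsub C', adjacent_triangle w N i) ->
    forall (N : fullsub C') (j : int),
      representable_in C' (tau_ge w j (H_ C (sval N))) /\
      representable_in C' (tau_le w j (H_ C (sval N))).
  move=> /adjacent_triangle_all adj N j; split.
    (* The object w >= j of M is the right-hand term of its (j - 1)-weight decomposition, hence the
       index j - 1. *)
    have [L [R [f [g [h [fgh pL pR]]]]]] := adj (j - 1) N.
    exists L; apply: (tau_ge_iso _ _ (fgh : @dist D _ _ _ f g h)) => //.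
    exact: esym (subrK 1 (j - 1)).
  have [L [R [f [g [h [fgh pL pR]]]]]] := adj j N.
  by exists R; apply: (tau_le_iso _ erefl (fgh : @dist D _ _ _ f g h)).
tfae.
- move=> [t wt] N.
  by have [] := rep_ge (-1) (fun N => t_structure_adjacent_triangle N wt) N 0.
- move=> rep N; apply: (proj2 (rep_ge (0 - 1) _ N (-1))) => {}N.
  exact: (tau_ge_triangle (esym (subrK 1 (0 - 1))) reflC (rep N)).
- move=> rep; apply: (rep_ge (-1)) => N.
  exact: (tau_le_triangle erefl reflC (rep N)).
- move=> rep; apply: adjacent_t_structure => // N.
  exact: (tau_le_triangle erefl reflC (proj2 (rep N _))).
Qed.
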